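(* If $G$ is a cubic graph (a finite simple graph in which every vertex has degree $3$), then $C_2(G)=4$.
   Context: A set $S\subseteq V(G)$ is a $2$-dominating set of $G$ if every vertex $v\in V(G)\setminus S$ has at least $2$ neighbors in $S$. Two disjoint sets $A,B\subseteq V(G)$ form a $2$-coalition if neither $A$ nor $B$ is a $2$-dominating set of $G$ but $A\cup B$ is a $2$-dominating set of $G$. A $2$-coalition partition of $G$ is a partition $\Theta$ of $V(G)$ such that every set in $\Theta$ is either a $2$-dominating set of cardinality $2$ or forms a $2$-coalition with another set of $\Theta$. $C_2(G)$ is the maximum cardinality of a $2$-coalition partition of $G$. *)

(* Defs.v *)
From mathcomp Require Import all_boot.

Set Implicit Arguments.
Unset Strict Implicit.
Unset Printing Implicit Defensive.

(* A finite simple graph is a symmetric irreflexive relation [e : rel T] on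
   its finite vertex type [T]. *)

Section TwoCoalition.
Variables (T : finType) (e : rel T).
Implicit Types (A B S : {set T}) (P : {set {set T}}).

Definition neighbors (v : T) : {set T} := [set u | e v u].

Definition cubic : bool := [forall v, #|neighbors v| == 3].

Definition two_dominating S : bool :=
  [forall v in ~: S, 2 <= #|neighbors v :&: S|].

Definition two_coalition A B : bool :=
  [&& [disjoint A & B], ~~ two_dominating A, ~~ two_dominating B
    & two_dominating (A :|: B)].

(* [partition] requires the blocks to be nonempty. *)
Definition two_coalition_partition P : bool :=
  partition P [set: T] &&
  [forall A in P,
    (two_dominating A && (#|A| == 2))
    || [exists B in P, (B != A) && two_coalition A B]].

(* The value is 0 when no 2-coalition partition exists. *)
Definition two_coalition_number : nat :=
  \max_(P : {set {set T}} | two_coalition_partition P) #|P|.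

End TwoCoalition.

(* Main.v *)
Require Import Defs.
From mathcomp Require Import all_boot.
From mathcomp Require Import zify.

(** Lower bound: a maximum cut [S], [~: S] splits the graph into two
    2-dominating sets. A vertex outside two disjoint 2-dominating sets would
    have degree at least 4, so both sides are minimal 2-dominating sets, and
    splitting each of them into two nonempty parts gives two 2-coalitions.

    Upper bound: let a partition have at least five blocks. Two disjoint
    2-coalitions would give a vertex of a fifth block degree at least 4, so the
    coalition graph is a star. A vertex [v] that witnesses that the center [A]
    is not 2-dominating has at most one neighbor in [A], and needs one in each
    of the three or more other blocks that do not contain [v]; with 2-domination
    this again exceeds degree 3. *)

Section Cubic.
Set Implicit Arguments.
Unset Strict Implicit.
Variables (T : finType) (e : rel T).
Hypotheses (e_sym : symmetric e) (e_irr : irreflexive e) (e_cubic : cubic e).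
Implicit Types (A B S : {set T}) (P : {set {set T}}).

Local Notation N := (neighbors e).
Local Notation dom := (two_dominating e).
Local Notation coal := (two_coalition e).

(** * Basic facts on neighbor counts and 2-domination *)

Lemma card_neighbors v : #|N v| = 3.
Proof. by apply/eqP/(forallP e_cubic). Qed.

Lemma two_dominatingP S :
  reflect (forall v, v \notin S -> 2 <= #|N v :&: S|) (dom S).
Proof.
apply: (iffP forall_inP) => H v vS; apply: H; first by rewrite inE.
by rewrite inE in vS.
Qed.

Lemma two_dominatingPn S :
  ~~ dom S -> exists2 v, v \notin S & #|N v :&: S| <= 1.
Proof.
rewrite negb_forall_in => /exists_inP[v]; rewrite inE -ltnNge => vS.
by exists v.
Qed.

Lemma two_coalition_sym A B : coal A B = coal B A.
Proof.
rewrite /two_coalition disjoint_sym setUC.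
by case: [disjoint B & A]; case: (dom A); case: (dom B).
Qed.

Lemma two_coalition_card A B v : coal A B -> v \notin A -> v \notin B ->
  2 <= #|N v :&: A| + #|N v :&: B|.
Proof.
case/and4P => _ _ _ /two_dominatingP H vA vB.
have := H v; rewrite inE (negbTE vA) (negbTE vB) setIUr => /(_ isT) /leq_trans.
by apply; rewrite cardsU leq_subr.
Qed.

(** Turns a neighbor count into a sum of adjacency bits, which can be regrouped over blocks or split
    at one vertex. *)
Lemma sum_edges v A : \sum_(w in A) (e v w : nat) = #|N v :&: A|.
Proof.
rewrite -sum1_card; under [RHS]eq_bigl do rewrite !inE andbC.
by rewrite [RHS]big_mkcondr; apply: eq_bigr => w _; case: (e v w).
Qed.

(** * Upper bound: distributing the degree over the blocks *)

Section Partition.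
Variable P : {set {set T}}.
Hypothesis P_partition : partition P [set: T].

Lemma sum_card_neighbors v : \sum_(A in P) #|N v :&: A| = 3.
Proof.
have /and3P[/eqP covP tiP _] := P_partition.
under eq_bigr do rewrite -sum_edges.
by rewrite -big_trivIset // covP sum_edges setIT card_neighbors.
Qed.

Lemma sum_card_neighbors_le v (s : seq {set T}) : uniq s -> {subset s <= P} ->
  \sum_(A <- s) #|N v :&: A| <= 3.
Proof.
move=> us sP; rewrite -(sum_card_neighbors v) big_uniq //.
rewrite big_mkcond [leqRHS]big_mkcond; apply: leq_sum => A _.
by case: ifP => // /sP ->.
Qed.

Lemma block_neq0 A : A \in P -> A != set0.
Proof. by case/and3P: P_partition => _ _ P0 AP; apply: contraNneq P0 => <-. Qed.

Lemma block_disjoint A B v : A \in P -> B \in P -> A != B -> v \in A ->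
  v \notin B.
Proof.
move=> AP BP AB vA; case/and3P: P_partition => _ /trivIsetP H _.
by have /disjointFr/(_ vA) -> := H A B AP BP AB.
Qed.

Lemma block_of v : exists2 A, A \in P & v \in A.
Proof.
exists (pblock P v); last by rewrite mem_pblock (cover_partition P_partition).
by rewrite pblock_mem // (cover_partition P_partition).
Qed.

Lemma fresh_block (s : seq {set T}) : size s < #|P| ->
  exists2 A, A \in P & A \notin s.
Proof.
move=> sP; apply/subsetPn; apply: contraL sP => /subset_leq_card PS.
by rewrite -leqNgt (leq_trans PS) ?card_size.
Qed.

(** Each counting contradiction below comes from violating this bound. *)
Lemma four_blocks v A B C D : A \in P -> B \in P -> C \in P -> D \in P ->
  uniq [:: A; B; C; D] ->
  #|N v :&: A| + #|N v :&: B| + #|N v :&: C| + #|N v :&: D| <= 3.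
Proof.
move=> AP BP CP DP /(sum_card_neighbors_le v).
rewrite !big_cons big_nil addn0 !addnA; apply.
by move=> E; rewrite !inE => /or4P[] /eqP->.
Qed.

Hypothesis P_large : 4 < #|P|.

Lemma three_more_blocks A B : exists C D E,
  [/\ C \in P, D \in P, E \in P, uniq [:: C; D; E]
    & {in [:: C; D; E], forall X, X != A /\ X != B}].
Proof.
have [C CP] := @fresh_block [:: A; B] (ltnW (ltnW P_large)).
have [D DP] := @fresh_block [:: C; A; B] (ltnW P_large).
have [E EP] := @fresh_block [:: D; C; A; B] P_large.
rewrite !inE !negb_or => /and4P[ED EC EA EB] /and3P[DC DA DB] /andP[CA CB].
exists C, D, E; split=> //.
  by rewrite /= !inE negb_or !(eq_sym C) DC EC eq_sym ED.
by move=> X; rewrite !inE => /or3P[] /eqP->.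
Qed.

(** If [A] were 2-dominating, every vertex outside it would be adjacent to both members of [A]. A
    member [a] would then have a neighbor in each of four other blocks. *)
Lemma no_dominating_pair A : A \in P -> #|A| = 2 -> ~~ dom A.
Proof.
move=> AP A2; apply/negP => /two_dominatingP domA.
have [a aA] : exists a, a \in A by apply/set0Pn; rewrite -card_gt0 A2.
have adj B : B \in P -> B != A -> 0 < #|N a :&: B|.
  move=> BP BA; have /set0Pn[b bB] := block_neq0 BP.
  have := domA _ (block_disjoint BP AP BA bB).
  rewrite -A2 card_gt0 => bA; apply/set0Pn; exists b.
  have : N b :&: A == A by rewrite eqEcard subsetIr.
  by move/eqP/setP/(_ a); rewrite !inE aA bB !andbT e_sym => ->.
have [B BP] := @fresh_block [:: A] (ltnW (ltnW (ltnW P_large))).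
rewrite inE => BA; have [C [D [E [CP DP EP u ne]]]] := three_more_blocks A B.
have [[CA CB] [DA DB] [EA EB]] :
  [/\ C != A /\ C != B, D != A /\ D != B & E != A /\ E != B].
  by split; apply: ne; rewrite !inE eqxx ?orbT.
have := four_blocks a BP CP DP EP.
rewrite cons_uniq u !inE !negb_or !(eq_sym B) CB DB EB => /(_ isT).
by move: (adj B BP BA) (adj C CP CA) (adj D DP DA) (adj E EP EA); clear; lia.
Qed.

Lemma no_disjoint_coalitions A B C D :
  A \in P -> B \in P -> C \in P -> D \in P ->
  uniq [:: A; B; C; D] -> coal A B -> coal C D -> False.
Proof.
move=> AP BP CP DP u cAB cCD.
have [X XP] := @fresh_block [:: A; B; C; D] P_large.
rewrite !inE !negb_or => /and4P[XA XB XC XD].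
have /set0Pn[v vX] := block_neq0 XP.
have vN Y (YP : Y \in P) (XY : X != Y) := block_disjoint XP YP XY vX.
have := four_blocks v AP BP CP DP u.
have := two_coalition_card cAB (vN A AP XA) (vN B BP XB).
by have := two_coalition_card cCD (vN C CP XC) (vN D DP XD); clear; lia.
Qed.

(** If [v] has [k <= 1] neighbors in [A], it has at least [2 - k] in each of three other blocks,
    hence degree at least [k + 3 * (2 - k) >= 4]. *)
Lemma no_coalition_star A : A \in P ->
  {in P, forall B, B != A -> coal B A} -> False.
Proof.
move=> AP star.
have [B BP] := @fresh_block [:: A] (ltnW (ltnW (ltnW P_large))).
rewrite inE => /(star B BP)/and4P[_ _ /two_dominatingPn[v vA v1] _].
have [X XP vX] := block_of v.
(* The block [X] of [v] is avoided because 2-domination says nothing about vertices inside the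
   dominating set. *)
have [C [D [E [CP DP EP u ne]]]] := three_more_blocks A X.
have [[CA CX] [DA DX] [EA EX]] :
  [/\ C != A /\ C != X, D != A /\ D != X & E != A /\ E != X].
  by split; apply: ne; rewrite !inE eqxx ?orbT.
have nb Y : Y \in P -> Y != A -> Y != X -> 2 <= #|N v :&: Y| + #|N v :&: A|.
  move=> YP YA YX; apply: two_coalition_card (star Y YP YA) _ vA.
  by apply: block_disjoint vX; rewrite // eq_sym.
have := four_blocks v AP CP DP EP.
rewrite cons_uniq u !inE !negb_or !(eq_sym A) CA DA EA => /(_ isT).
by move: (nb C CP CA CX) (nb D DP DA DX) (nb E EP EA EX) v1; clear; lia.
Qed.

Lemma no_large_coalition_partition :
  ~ {in P, forall A, exists B, [/\ B \in P, B != A & coal A B]}.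
Proof.
move=> partner.
(* If [C] is a partner of [A], every further block also has to use [A]. *)
have star A B C : A \in P -> B \in P -> C \in P -> B != A -> C != A -> C != B ->
    coal A B -> coal C A -> False.
  move=> AP BP CP BA CA CB cAB cCA; apply: (no_coalition_star AP) => D DP DA.
  have [-> | DB] := eqVneq D B; first by rewrite two_coalition_sym.
  have [-> // | DC] := eqVneq D C.
  have [E [EP ED cDE]] := partner D DP.
  have [<- // | EA] := eqVneq E A.
  (* A partner [E] of [D] other than [A] leaves two disjoint coalitions: [C], [A] and [D], [B] if
     [E] is [B], and otherwise [A], [B] and [D], [E]. *)
  have [EB | EB] := eqVneq E B.
    subst E; have [] := @no_disjoint_coalitions C A D B => //.
    by rewrite /= !inE !negb_or !(eq_sym A) CA (eq_sym C) DC CB DA BA DB.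
  have [] := @no_disjoint_coalitions A B D E => //.
  rewrite /= !inE !negb_or !(eq_sym A) BA DA EA !(eq_sym B) DB EB.
  by rewrite (eq_sym D) ED.
have [A AP _] := @fresh_block [::] (ltn_trans (isT : 0 < 4) P_large).
have [B [BP BA cAB]] := partner A AP.
have [C CP] := @fresh_block [:: A; B] (ltnW (ltnW P_large)).
rewrite !inE negb_or => /andP[CA CB].
have [D [DP DC cCD]] := partner C CP.
(* The coalition of [C] and [D] must meet that of [A] and [B], and the shared block becomes the
   center of the star. *)
have [DA | DA] := eqVneq D A.
  by apply: (star A B C) => //; rewrite -DA.
have [DB | DB] := eqVneq D B.
  by apply: (star B A C);
    rewrite // 1?eq_sym // 1?two_coalition_sym // -DB 1?two_coalition_sym.
have [] := @no_disjoint_coalitions A B C D => //.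
rewrite /= !inE !negb_or !(eq_sym A) BA CA DA !(eq_sym B) CB DB.
by rewrite (eq_sym C) DC.
Qed.

End Partition.

Lemma two_coalition_partition_le4 P :
  two_coalition_partition e P -> #|P| <= 4.
Proof.
case/andP => partP /forall_inP H; rewrite leqNgt; apply/negP => P_large.
apply: (no_large_coalition_partition partP P_large) => A AP.
have /orP[/andP[domA /eqP A2] | /exists_inP[B BP /andP[BA cAB]]] := H A AP.
  by have := no_dominating_pair partP P_large AP A2; rewrite domA.
by exists B.
Qed.

(** * Lower bound: maximum cuts *)

Definition cut_size S := \sum_(u in S) #|N u :&: ~: S|.

(** When [v] joins [S], its edges to [S] leave the cut and its edges to the complement enter it. The
    additive form avoids truncated subtraction. *)
Lemma cut_sizeU1 v S : v \notin S ->
  cut_size (v |: S) + #|N v :&: S| = cut_size S + #|N v :&: ~: S|.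
Proof.
move=> vS; rewrite /cut_size big_setU1 //=.
have -> : N v :&: ~: (v |: S) = N v :&: ~: S.
  by apply/setP => w; rewrite !inE; case: eqVneq => [->|]; rewrite ?e_irr.
(* The identity reduces to one for each [u] in [S], whose count across the cut drops by the bit
   [e u v]. *)
rewrite -[#|N v :&: S|]sum_edges -addnA -big_split /= addnC; congr (_ + _).
apply: eq_bigr => u uS; rewrite -(sum_edges u (~: S)) (big_setD1 v) ?inE //=.
by rewrite addnC e_sym sum_edges setCU (setIC (~: [set v])) -setDE.
Qed.

Lemma card_neighborsC v S : #|N v :&: S| + #|N v :&: ~: S| = 3.
Proof. by rewrite -setDE cardsID card_neighbors. Qed.

(** At a maximum cut, no vertex has more neighbors on its own side than across. Since the degree is
    3, at least two are across. *)
Lemma dominating_bipartition : exists S, dom S /\ dom (~: S).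
Proof.
have [S _ Smax] := @arg_maxnP _ set0 predT cut_size isT.
exists S; split; apply/two_dominatingP => v vS.
  have := Smax (v |: S) isT; have := cut_sizeU1 vS.
  by have := card_neighborsC v S; clear; lia.
rewrite inE negbK in vS.
(* Moving [v] out of [S] is the reverse of adding it to [S :\ v]; by irreflexivity [v] has the same
   neighbors in both sets. *)
have vS' : v \notin S :\ v by rewrite !inE eqxx.
have NvS : N v :&: (S :\ v) = N v :&: S.
  by apply/setP => w; rewrite !inE; case: eqVneq => [->|]; rewrite ?e_irr.
have := cut_sizeU1 vS'; rewrite setD1K // NvS.
have := Smax (S :\ v) isT; have := card_neighborsC v S.
by have := card_neighborsC v (S :\ v); rewrite NvS; clear; lia.
Qed.

(** * Lower bound: splitting the two sides into coalitions *)

Lemma disjoint_dominating_cover A B v :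
  dom A -> dom B -> [disjoint A & B] -> (v \in A) || (v \in B).
Proof.
move=> /two_dominatingP dA /two_dominatingP dB dAB.
apply: contraT; rewrite negb_or => /andP[/dA vA /dB vB].
have := card_neighborsC v A.
have /subset_leq_card : N v :&: B \subset N v :&: ~: A.
  by rewrite setIS // subsets_disjoint setCK disjoint_sym.
by move: vA vB; clear; lia.
Qed.

(** A vertex of [S] missing from [A] lies outside both [A] and [~: S], which cannot both be
    2-dominating as they are disjoint. *)
Lemma not_dominating_proper A S :
  A \proper S -> dom (~: S) -> ~~ dom A.
Proof.
case/properP => AS [x xS xA] dS; apply/negP => dA.
have dAS : [disjoint A & ~: S] by rewrite -subsets_disjoint.
by have := disjoint_dominating_cover x dA dS dAS; rewrite inE xS (negbTE xA).
Qed.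

Lemma dominating_card S : dom S -> ~: S != set0 -> 1 < #|S|.
Proof.
move=> /two_dominatingP dS /set0Pn[v]; rewrite inE => /dS /leq_trans; apply.
by rewrite subset_leq_card ?subsetIr.
Qed.

(* Both parts are proper subsets of [S], which is a minimal 2-dominating set. *)
Lemma dominating_split S : dom S -> dom (~: S) -> ~: S != set0 ->
  exists A B, [/\ A != set0, B != set0, A :|: B = S & coal A B].
Proof.
move=> dS dS' S'0; have /card_gt1P[a [b [aS bS ab]]] := dominating_card dS S'0.
exists [set a], (S :\ a).
have S1 : [set a] :|: S :\ a = S by rewrite setD1K.
split=> //; first by apply/set0Pn; exists a; rewrite set11.
  by apply/set0Pn; exists b; rewrite !inE eq_sym ab.
rewrite /two_coalition S1 dS andbT disjoints1 !inE eqxx /=.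
rewrite !(@not_dominating_proper _ S) //; first exact: properD1.
by apply/properP; rewrite sub1set; split=> //; exists b; rewrite // inE eq_sym.
Qed.

(** Excludes the empty graph, where the empty set is vacuously 2-dominating. *)
Lemma dominating_neq0 S : 0 < #|T| -> dom S -> S != set0.
Proof.
move=> /card_gt0P[v _] /two_dominatingP dS; apply/eqP => S0.
by have := dS v; rewrite S0 inE setI0 cards0 => /(_ isT).
Qed.

Lemma partition4 (A B C D S : {set T}) :
  A != set0 -> B != set0 -> C != set0 -> D != set0 ->
  [disjoint A & B] -> [disjoint C & D] -> A :|: B = S -> C :|: D = ~: S ->
  partition [set A; B; C; D] [set: T] /\ #|[set A; B; C; D]| = 4.
Proof.
move=> A0 B0 C0 D0 dAB dCD AB CD.
have dS (X Y : {set T}) : X \subset S -> Y \subset ~: S -> [disjoint X & Y].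
  move=> XS YS; rewrite (disjointWl XS) // (disjointWr YS) //.
  by rewrite -subsets_disjoint.
have [AS BS] : A \subset S /\ B \subset S by rewrite -AB subsetUl subsetUr.
have [CS DS] : C \subset ~: S /\ D \subset ~: S.
  by rewrite -CD subsetUl subsetUr.
have [dAC dAD] := (dS A C AS CS, dS A D AS DS).
have [dBC dBD] := (dS B C BS CS, dS B D BS DS).
(* Nonempty disjoint blocks are distinct, so the set of four blocks does not collapse. *)
have neq (X Y : {set T}) : X != set0 -> [disjoint X & Y] -> (X == Y) = false.
  move=> X0 dXY; apply: contraNF X0 => /eqP XY.
  by rewrite -setI_eq0 -XY setIid in dXY.
(* Reassociated so that [cardsU1] and [partitionU1] peel off one block at a time. *)
have -> : [set A; B; C; D] = A |: (B |: (C |: [set D])) by rewrite !setUA.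
split; last first.
  rewrite !cardsU1 cards1 !inE (neq A B) // (neq A C) // (neq A D) //.
  by rewrite (neq B C) // (neq B D) // (neq C D).
have -> : [set: T] = A :|: (B :|: (C :|: D)) by rewrite CD setUA AB setUCr.
have partD : partition [set D] D.
  by rewrite /partition cover1 eqxx trivIset1 !inE eq_sym D0.
apply: partitionU1 => //.
  apply: partitionU1 (partitionU1 partD C0 dCD) B0 _.
  by rewrite CD -subsets_disjoint.
by rewrite -setI_eq0 setIUr setU_eq0 !setI_eq0 dAB CD -subsets_disjoint.
Qed.

Lemma two_coalition_partition4 : 0 < #|T| ->
  exists2 P, two_coalition_partition e P & #|P| = 4.
Proof.
move=> T0; have [S [dS dS']] := dominating_bipartition.
have S0 := dominating_neq0 T0 dS; have S'0 := dominating_neq0 T0 dS'.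
have [A [B [A0 B0 AB cAB]]] := dominating_split dS dS' S'0.
have [||C [D [C0 D0 CD cCD]]] := @dominating_split (~: S) dS';
  rewrite ?setCK //.
have /and4P[dAB _ _ _] := cAB; have /and4P[dCD _ _ _] := cCD.
have [partP P4] := partition4 A0 B0 C0 D0 dAB dCD AB CD.
exists [set A; B; C; D]; rewrite // /two_coalition_partition partP /=.
have neq (X Y : {set T}) : X != set0 -> coal X Y -> X != Y.
  move=> X0 /and4P[dXY _ _ _]; apply: contraNneq X0 => XY.
  by rewrite -setI_eq0 -XY setIid in dXY.
have [nAB nCD] := (neq A B A0 cAB, neq C D C0 cCD).
apply/forall_inP => X; rewrite !inE => PX; apply/orP; right; apply/exists_inP.
case/orP: PX => [/orP[/orP[]|]|] /eqP->.
- by exists B; rewrite ?inE ?eqxx ?orbT // eq_sym nAB.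
- by exists A; rewrite ?inE ?eqxx ?orbT // nAB two_coalition_sym.
- by exists D; rewrite ?inE ?eqxx ?orbT // eq_sym nCD.
- by exists C; rewrite ?inE ?eqxx ?orbT // nCD two_coalition_sym.
Qed.

End Cubic.

Theorem theorem4p1 (T : finType) (e : rel T)
  (e_sym : symmetric e) (e_irr : irreflexive e)
  (T_nonempty : 0 < #|T|) (e_cubic : cubic e) :
  two_coalition_number e = 4.
Proof.
apply/eqP; rewrite eqn_leq; apply/andP; split.
  by apply/bigmax_leqP => P; apply: two_coalition_partition_le4.
have [P cP <-] := two_coalition_partition4 e_sym e_irr e_cubic T_nonempty.
exact: (@leq_bigmax_cond _ _ (fun P : {set {set T}} => #|P|)).
Qed.
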